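(* Let $m>3$ be a square-free integer, let $K=\mathbb{Q}(\sqrt{-m})$, and let $\mathcal{P}_m$, $E$, $L$ and $L_0$ be as defined in the context (for some choice of lifting $l$). If $L_0=L$, then $\mathcal{P}_m$ is a free abelian group, and a free basis of it is given by the set of all classes $[a,b,p]$ and $[a,b,2p]$ of primitive triples, where $p\in L$ and $a,b$ are positive integers such that $a^2+mb^2=p^2$ (for the classes $[a,b,p]$), respectively $a^2+mb^2=(2p)^2$ (for the classes $[a,b,2p]$).
   Context: Let $m>3$ be a fixed square-free integer. A triple $(a,b,c)\in\mathbb{Z}\times\mathbb{Z}\times\mathbb{N}$ with $a^2+mb^2=c^2$ is primitive if $\gcd(a,b,c)=1$. Two such triples $(a,b,c)$, $(A,B,C)$ are equivalent if there are nonzero integers $s,t$ with $s(a,b,c)=t(A,B,C)$, where $s(a,b,c)=(sa,sb,|sc|)$; the class of $(a,b,c)$ is denoted $[a,b,c]$ (this notation is also used for non-primitive solutions, the class being that of the triple up to such scaling). The set $\mathcal{P}_m$ of classes is an abelian group under $[a,b,c]+[A,B,C]=[aA-mbB,\,aB+bA,\,cC]$, with identity $[1,0,1]$ and $-[a,b,c]=[a,-b,c]=[-a,b,c]$ (note $[a,b,c]=[-a,-b,c]$). Let $K=\mathbb{Q}(\sqrt{-m})$, $\mathcal{O}_K$ its ring of integers, $Cl(K)$ its ideal class group, $\mathbb{P}$ the set of rational primes, $P(\mathcal{O}_K)$ the set of nonzero prime ideals of $\mathcal{O}_K$, $\mu:P(\mathcal{O}_K)\to\mathbb{P}$ the map sending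 a prime ideal to the rational prime below it, and $\pi:P(\mathcal{O}_K)\to Cl(K)$ the map to ideal classes. Fix a lifting $l:\mathbb{P}\to P(\mathcal{O}_K)$ with $\mu\circ l=\mathrm{id}$, and put $f=\pi\circ l:\mathbb{P}\to Cl(K)$. Let $E=\{x\in Cl(K): x^2=1\}$. Let $L$ be the set of primes $p$ with Kronecker symbol $\left(\frac{-m}{p}\right)=1$, i.e. $p$ odd with Legendre symbol $\left(\frac{-m}{p}\right)=1$, or $p=2$ and $-m\equiv 1\pmod 8$. Let $L_0=f^{-1}(E)\cap L$. *)

(* Defs.v *)
From HB Require Import structures.
From mathcomp Require Import all_boot all_order all_algebra all_field.
From mathcomp Require Import boolp classical_sets.
From mathcomp Require Import ring zify.

Set Implicit Arguments.
Unset Strict Implicit.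
Unset Printing Implicit Defensive.

Import Order.TTheory GRing.Theory Num.Theory.

Local Open Scope ring_scope.
Local Open Scope quotient_scope.
Local Open Scope classical_set_scope.

Definition square_free (m : nat) : Prop :=
  forall d : nat, (d ^ 2 %| m)%N -> d = 1%N.

Definition Primes : Type := {p : nat | prime p}.

Definition Z_basis (V : zmodType) (B : set V) : Prop :=
  (forall x : V, exists (s : seq V) (n : V -> int),
      (forall b, b \in s -> B b) /\ x = \sum_(b <- s) b *~ n b) /\
  (forall (s : seq V) (n : V -> int),
      uniq s -> (forall b, b \in s -> B b) ->
      \sum_(b <- s) b *~ n b = 0 -> forall b, b \in s -> n b = 0).

Definition free_abelian (V : zmodType) : Prop := exists B : set V, Z_basis B.

(* c is required to be positive: c = 0 forces a = b = 0, and this triple has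
   to be excluded. *)
Definition is_triple (m : nat) (t : int * int * nat) : bool :=
  (0 < t.2)%N && (t.1.1 ^+ 2 + m%:Z * t.1.2 ^+ 2 == t.2%:Z ^+ 2).

Record triple (m : nat) := Triple {
  triple_val :> int * int * nat;
  tripleP : is_triple m triple_val }.

HB.instance Definition _ (m : nat) := [isSub for @triple_val m].
HB.instance Definition _ (m : nat) := [Choice of triple m by <:].

Section Triples.
Variable m : nat.
Implicit Types t u v : triple m.

Definition tA t : int := (triple_val t).1.1.
Definition tB t : int := (triple_val t).1.2.
Definition tC t : nat := (triple_val t).2.

Definition primitive t : Prop := gcdn (gcdn `|tA t|%N `|tB t|%N) (tC t) = 1%N.

Lemma tC_gt0 t : (0 < tC t)%N.
Proof. by have /andP[] := tripleP t. Qed.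

Lemma tripleE t : tA t ^+ 2 + m%:Z * tB t ^+ 2 = (tC t)%:Z ^+ 2.
Proof. by have /andP[_ /eqP] := tripleP t. Qed.

(* s (a, b, c) = (s a, s b, |s c|) *)
Definition tscale (s : int) (t : int * int * nat) : int * int * nat :=
  (s * t.1.1, s * t.1.2, absz (s * t.2%:Z)).

Definition triple_equiv t u : bool :=
  `[< exists s r : int, [/\ s != 0, r != 0 & tscale s t = tscale r u] >].

Lemma triple_equiv_refl : reflexive triple_equiv.
Proof. by move=> t; apply/asboolP; exists 1, 1. Qed.

Lemma triple_equiv_sym : symmetric triple_equiv.
Proof.
by move=> t u; apply/asboolP/asboolP => -[s [r [s0 r0 e]]]; exists r, s.
Qed.

Lemma tscaleM s r t : tscale s (tscale r t) = tscale (s * r) t.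
Proof.
by rewrite /tscale /= !mulrA -mulrA !abszM absz_nat mulnA.
Qed.

Lemma triple_equiv_trans : transitive triple_equiv.
Proof.
move=> u t v /asboolP[s [r [s0 r0 e]]] /asboolP[s' [r' [s'0 r'0 e']]].
apply/asboolP; exists (s' * s), (r * r'); split; rewrite ?mulf_neq0 //.
by rewrite -(tscaleM s') e -(tscaleM r) -e' !tscaleM mulrC.
Qed.

Canonical triple_equiv_equiv :=
  EquivRel triple_equiv triple_equiv_refl triple_equiv_sym triple_equiv_trans.

Definition Pm := {eq_quot triple_equiv}.
HB.instance Definition _ := Choice.on Pm.
HB.instance Definition _ := EqQuotient.on Pm.

Definition tclass t : Pm := \pi_Pm t.

Lemma tclassP t u :
  (exists s r : int, [/\ s != 0, r != 0 & tscale s t = tscale r u]) <->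
  tclass t = tclass u.
Proof.
split=> [h|/eqP]; first by apply/eqP; rewrite eqmodE /=; apply/asboolP.
by rewrite eqmodE /= => /asboolP.
Qed.

Lemma is_triple0 : is_triple m (1, 0, 1%N).
Proof. by rewrite /is_triple /= expr0n mulr0 addr0. Qed.

Lemma is_tripleN t : is_triple m (tA t, - tB t, tC t).
Proof. by rewrite /is_triple /= tC_gt0 sqrrN tripleE eqxx. Qed.

Lemma is_tripleD t u :
  is_triple m (tA t * tA u - m%:Z * tB t * tB u,
               tA t * tB u + tB t * tA u, (tC t * tC u)%N).
Proof.
rewrite /is_triple /= muln_gt0 !tC_gt0 /= PoszM exprMn -!tripleE.
by apply/eqP; ring.
Qed.

Definition triple0 : triple m := Triple is_triple0.
Definition tripleN t : triple m := Triple (is_tripleN t).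
Definition tripleD t u : triple m := Triple (is_tripleD t u).

Definition Pm_zero : Pm := tclass triple0.
Definition Pm_opp (x : Pm) : Pm := tclass (tripleN (repr x)).
Definition Pm_add (x y : Pm) : Pm := tclass (tripleD (repr x) (repr y)).

Lemma tclass_repr x : tclass (repr x) = x.
Proof. exact: reprK. Qed.

Lemma Pm_oppE t : Pm_opp (tclass t) = tclass (tripleN t).
Proof.
have /tclassP[s [r [s0 r0 [ea eb ec]]]] := tclass_repr (tclass t).
apply/tclassP; exists s, r; split=> //; rewrite /tscale /= !mulrN.
by congr (_, - _, _).
Qed.

Lemma Pm_addE t u : Pm_add (tclass t) (tclass u) = tclass (tripleD t u).
Proof.
rewrite /Pm_add; move: (repr _) (repr _) (tclass_repr (tclass t))
  (tclass_repr (tclass u)) => u' t'.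
move=> /tclassP[s [r [s0 r0 [ea eb ec]]]] /tclassP[s' [r' [s'0 r'0 [ea' eb' ec']]]].
apply/tclassP; exists (s * s'), (r * r'); split; rewrite ?mulf_neq0 //.
rewrite /tscale /=.
rewrite -/(tA t') -/(tA t) -/(tB t') -/(tB t) -/(tC t') -/(tC t) in ea eb ec.
rewrite -/(tA u') -/(tA u) -/(tB u') -/(tB u) -/(tC u') -/(tC u) in ea' eb' ec'.
have -> : s * s' * (tA t' * tA u' - m%:Z * tB t' * tB u') =
  (s * tA t') * (s' * tA u') - m%:Z * (s * tB t') * (s' * tB u') by ring.
have -> : s * s' * (tA t' * tB u' + tB t' * tA u') =
  (s * tA t') * (s' * tB u') + (s * tB t') * (s' * tA u') by ring.
have -> : s * s' * (tC t' * tC u')%N = (s * tC t') * (s' * tC u').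
  by rewrite PoszM; ring.
rewrite ea eb ea' eb' abszM ec ec' -abszM PoszM.
by congr (_, _, absz _); ring.
Qed.

Lemma tclass_eq t u : triple_val t = triple_val u -> tclass t = tclass u.
Proof. by move=> e; congr tclass; apply: val_inj. Qed.

Lemma Pm_ind (P : Pm -> Prop) : (forall t, P (tclass t)) -> forall x, P x.
Proof. by move=> h x; rewrite -(tclass_repr x). Qed.

Lemma Pm_addA : associative Pm_add.
Proof.
elim/Pm_ind=> t; elim/Pm_ind=> u; elim/Pm_ind=> v; rewrite !Pm_addE.
by apply: tclass_eq; rewrite /= /tA /tB /tC /= mulnA; congr (_, _, _); ring.
Qed.

Lemma Pm_addC : commutative Pm_add.
Proof.
elim/Pm_ind=> t; elim/Pm_ind=> u; rewrite !Pm_addE.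
by apply: tclass_eq; rewrite /= mulnC; congr (_, _, _); ring.
Qed.

Lemma Pm_add0 : left_id Pm_zero Pm_add.
Proof.
elim/Pm_ind=> t; rewrite Pm_addE; apply: tclass_eq => /=.
case: t => [[[a b] c] h]; rewrite /tA /tB /tC /= mul1n.
by congr (_, _, _); ring.
Qed.

Lemma Pm_addN : left_inverse Pm_zero Pm_opp Pm_add.
Proof.
elim/Pm_ind=> t; rewrite Pm_oppE Pm_addE; apply/tclassP.
exists 1, ((tC t)%:Z ^+ 2); split=> //.
  by rewrite expf_neq0 // eqz_nat -lt0n tC_gt0.
rewrite /tscale /= /tA /tB /tC /= -/(tA t) -/(tB t) -/(tC t).
congr (_, _, _); [by rewrite -tripleE; ring|by ring|].
by rewrite mul1n muln1.
Qed.

HB.instance Definition _ := GRing.isZmodule.Build Pm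
  Pm_addA Pm_addC Pm_add0 Pm_addN.

End Triples.

(* The field Q(sqrt(-m)), as a subfield of algC. *)
Definition Qsqrt (m : nat) : {pred algC} := fun x =>
  `[< exists u v : rat, x = ratr u + ratr v * sqrtC (- m%:R) >].

(* The ring of integers O_K: the algebraic integers lying in Q(sqrt(-m)). *)
Definition is_OK (m : nat) : {pred algC} :=
  fun x => (x \in Qsqrt m) && (x \in Aint).

Section QuadraticField.
Variable m : nat.
Local Notation w := (sqrtC (- m%:R) : algC).

Lemma QsqrtP x : reflect (exists u v : rat, x = ratr u + ratr v * w)
  (x \in Qsqrt m).
Proof. exact: asboolP. Qed.

Lemma Qsqrt_gen : w ^+ 2 = - m%:R. Proof. exact: sqrtCK. Qed.

Lemma conj_gen : w^* = - w.
Proof.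
have /eqP : (w^*) ^+ 2 = w ^+ 2 by rewrite -rmorphXn /= Qsqrt_gen rmorphN /= rmorph_nat.
rewrite eqf_sqr => /orP[] /eqP // /CrealP wR.
have : 0 <= w ^+ 2 by rewrite real_exprn_even_ge0.
rewrite Qsqrt_gen oppr_ge0 lern0 => /eqP ->.
by rewrite oppr0 sqrtC0 rmorph0 oppr0.
Qed.

Lemma conj_Qsqrt u v : (ratr u + ratr v * w)^* = ratr u - ratr v * w.
Proof. by rewrite rmorphD /= [(_ * w)^*]rmorphM /= conj_gen mulrN !conj_Crat ?Crat_rat. Qed.

Lemma norm_Qsqrt u v : (ratr u + ratr v * w) * (ratr u + ratr v * w)^* =
  ratr (u ^+ 2 + m%:R * v ^+ 2).
Proof.
rewrite conj_Qsqrt rmorphD rmorphM !rmorphXn /= rmorph_nat.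
move: w Qsqrt_gen => z ez.
have -> : m%:R = - z ^+ 2 :> algC by rewrite ez opprK.
by ring.
Qed.

Lemma Qsqrt_divring : divring_closed (Qsqrt m).
Proof.
split.
- by apply/QsqrtP; exists 1, 0; rewrite rmorph1 rmorph0 mul0r addr0.
- move=> _ _ /QsqrtP[u [v ->]] /QsqrtP[u' [v' ->]]; apply/QsqrtP.
  by exists (u - u'), (v - v'); rewrite !rmorphB /=; ring.
move=> _ _ /QsqrtP[u [v ->]] /QsqrtP[u' [v' ->]]; apply/QsqrtP.
set z' := ratr u' + _; have [z0|z0] := eqVneq z' 0.
  by exists 0, 0; rewrite z0 invr0 mulr0 !rmorph0 mul0r addr0.
pose n := u' ^+ 2 + m%:R * v' ^+ 2.
have en : z' * z'^* = ratr n := norm_Qsqrt u' v'.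
have n0 : ratr n != 0 :> algC by rewrite -en mulf_neq0 // conjC_eq0.
move: n en n0 => n en n0; exists ((u * u' + m%:R * v * v') / n), ((v * u' - u * v') / n).
have -> : z'^-1 = z'^* / ratr n.
  by rewrite -en invfM mulrCA mulfV ?mulr1 // conjC_eq0.
rewrite /z' conj_Qsqrt !(rmorphM, rmorphD, rmorphN, fmorphV) /= rmorph_nat.
move: w Qsqrt_gen => z ez.
have -> : m%:R = - z ^+ 2 :> algC by rewrite ez opprK.
by field.
Qed.

HB.instance Definition _ :=
  GRing.isDivringClosed.Build algC (Qsqrt m) Qsqrt_divring.

Lemma is_OK_subring : subring_closed (is_OK m).
Proof.
split=> [|x y|x y]; first by apply/andP; rewrite !rpred1.
- by move=> /andP[xK xA] /andP[yK yA]; apply/andP; rewrite !rpredB.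
- by move=> /andP[xK xA] /andP[yK yA]; apply/andP; rewrite !rpredM.
Qed.

HB.instance Definition _ :=
  GRing.isSubringClosed.Build algC (is_OK m) is_OK_subring.

Record OK := MkOK { OK_val :> algC; OK_valP : OK_val \in is_OK m }.

HB.instance Definition _ := [isSub for OK_val].
HB.instance Definition _ := [Choice of OK by <:].
HB.instance Definition _ := [SubChoice_isSubComNzRing of OK by <:].

Lemma OK_mulf_neq0 (x y : OK) : x != 0 -> y != 0 -> x * y != 0.
Proof.
by rewrite -!(inj_eq val_inj) /= => x0 y0; rewrite mulf_neq0.
Qed.

(* Every nonzero element of O_K divides its norm, a positive integer. *)
Lemma OK_norm (x : OK) : x != 0 ->
  exists (n : nat) (y : OK), (0 < n)%N /\ n%:R = y * x.
Proof.
case: x => x xO; have /andP[xK xA] := xO; rewrite -(inj_eq val_inj) /= => x0.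
have /QsqrtP[u [v ex]] := xK.
have yA : x^* \in Aint by rewrite Aint_aut.
have yO : x^* \in is_OK m.
  apply/andP; split=> //; apply/QsqrtP; exists u, (- v).
  by rewrite ex conj_Qsqrt rmorphN mulNr.
have : x * x^* \in Num.nat.
  rewrite natrEint mul_conjC_ge0 andbT Cint_rat_Aint //; last by rewrite rpredM.
  by rewrite ex norm_Qsqrt Crat_rat.
move=> /natrP[n en]; exists n, (MkOK yO); split.
  by rewrite lt0n -(eqr_nat algC) -en mulf_neq0 // conjC_eq0.
apply: val_inj; rewrite -[RHS]/(x^* * x) mulrC en.
exact: (rmorph_nat (val : OK -> algC)).
Qed.

End QuadraticField.

Section Ideals.
Variable R : comNzRingType.
Implicit Types I J : set R.

Definition is_ideal I : Prop :=
  [/\ I 0, (forall x y, I x -> I y -> I (x + y))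
    & (forall a x, I x -> I (a * x))].

Definition is_prime_ideal I : Prop :=
  [/\ is_ideal I, ~ I 1 & forall x y, I (x * y) -> I x \/ I y].

Definition ideal_mul I J : set R :=
  [set x | exists s : seq (R * R),
     (forall q, q \in s -> I q.1 /\ J q.2) /\ x = \sum_(q <- s) q.1 * q.2].

Definition ideal_scale (a : R) I : set R := [set a * x | x in I].

Lemma ideal_mul_ideal I J : is_ideal I -> is_ideal J -> is_ideal (ideal_mul I J).
Proof.
move=> [I0 ID IM] _; split.
- by exists [::]; split=> //; rewrite big_nil.
- move=> _ _ [s [hs ->]] [t [ht ->]]; exists (s ++ t).
  split=> [q|]; last by rewrite big_cat.
  by rewrite mem_cat => /orP[/hs|/ht].
move=> a _ [s [hs ->]]; exists [seq (a * q.1, q.2) | q <- s]; split=> [q|].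
  by move=> /mapP[q' /hs[h1 h2] ->]; split=> //; exact: IM.
by rewrite big_map mulr_sumr; apply: eq_bigr => q _; rewrite mulrA.
Qed.

Lemma ideal_mul_in I J x y : I x -> J y -> ideal_mul I J (x * y).
Proof.
move=> Ix Jy; exists [:: (x, y)]; split=> [q|]; last by rewrite big_seq1.
by rewrite inE => /eqP ->.
Qed.

Lemma ideal_scale_mul a b I J :
  ideal_mul (ideal_scale a I) (ideal_scale b J) =
  ideal_scale (a * b) (ideal_mul I J).
Proof.
apply/seteqP; split=> [x [s]|_ [_ [s [hs ->]] <-]].
  elim: s x => [|q s IHs] x [hs ->].
    by exists 0; [exists [::]; split=> //|]; rewrite ?big_nil ?mulr0.
  have [|y [t [ht ey]] e] := IHs (\sum_(q <- s) q.1 * q.2).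
    by split=> // q' q's; apply: hs; rewrite inE q's orbT.
  have [[u Iu eu] [v Jv ev]] := hs q (mem_head _ _).
  exists (u * v + y); last by rewrite big_cons -e -eu -ev; ring.
  exists ((u, v) :: t); split; last by rewrite big_cons ey.
  by move=> q'; rewrite inE => /orP[/eqP -> //|/ht].
exists [seq (a * q.1, b * q.2) | q <- s]; split.
  by move=> q /mapP[q' /hs[h1 h2] ->]; split; [exists q'.1|exists q'.2].
by rewrite big_map mulr_sumr; apply: eq_bigr => q _ /=; ring.
Qed.

Lemma ideal_scaleM a b I : ideal_scale a (ideal_scale b I) = ideal_scale (a * b) I.
Proof.
apply/seteqP; split=> [_ [_ [x Ix <-] <-]|_ [x Ix <-]].
  by exists x; rewrite ?mulrA.
by exists (b * x); [exists x|rewrite mulrA].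
Qed.

End Ideals.

Section ClassGroup.
Variable m : nat.
Local Notation OK := (OK m).

Record nzideal := NzIdeal {
  nzideal_set :> set OK;
  nzideal_ideal : is_ideal nzideal_set;
  nzideal_neq0 : exists2 x, nzideal_set x & x != 0 }.

HB.instance Definition _ := gen_eqMixin nzideal.
HB.instance Definition _ := gen_choiceMixin nzideal.

Lemma nzideal1_ideal : is_ideal [set: OK]. Proof. by split. Qed.
Lemma nzideal1_neq0 : exists2 x : OK, [set: OK] x & x != 0.
Proof. by exists 1; rewrite ?oner_neq0. Qed.
Definition nzideal1 : nzideal := NzIdeal nzideal1_ideal nzideal1_neq0.

Lemma nzideal_mul_neq0 (I J : nzideal) :
  exists2 x, ideal_mul I J x & x != 0.
Proof.
have [x Ix x0] := nzideal_neq0 I; have [y Jy y0] := nzideal_neq0 J.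
by exists (x * y); [exact: ideal_mul_in|exact: OK_mulf_neq0].
Qed.

Definition nzideal_mul (I J : nzideal) : nzideal :=
  NzIdeal (ideal_mul_ideal (nzideal_ideal I) (nzideal_ideal J))
          (nzideal_mul_neq0 I J).

(* Two nonzero ideals of O_K have the same class when they differ by a nonzero
   element of K, that is a I = b J with a, b nonzero in O_K. *)
Definition ideal_equiv (I J : nzideal) : bool :=
  `[< exists a b : OK, [/\ a != 0, b != 0 & ideal_scale a I = ideal_scale b J] >].

Lemma ideal_equiv_refl : reflexive ideal_equiv.
Proof. by move=> I; apply/asboolP; exists 1, 1; rewrite oner_neq0. Qed.

Lemma ideal_equiv_sym : symmetric ideal_equiv.
Proof.
by move=> I J; apply/asboolP/asboolP => -[a [b [a0 b0 e]]]; exists b, a.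
Qed.

Lemma ideal_equiv_trans : transitive ideal_equiv.
Proof.
move=> J I H /asboolP[a [b [a0 b0 e]]] /asboolP[a' [b' [a'0 b'0 e']]].
apply/asboolP; exists (a' * a), (b * b'); split; rewrite ?OK_mulf_neq0 //.
by rewrite -(ideal_scaleM a') e -(ideal_scaleM b) -e' !ideal_scaleM mulrC.
Qed.

Canonical ideal_equiv_equiv :=
  EquivRel ideal_equiv ideal_equiv_refl ideal_equiv_sym ideal_equiv_trans.

Definition Cl := {eq_quot ideal_equiv}.
HB.instance Definition _ := Choice.on Cl.
HB.instance Definition _ := EqQuotient.on Cl.

Definition iclass (I : nzideal) : Cl := \pi_Cl I.

Definition Cl_one : Cl := iclass nzideal1.
Definition Cl_mul (x y : Cl) : Cl := iclass (nzideal_mul (repr x) (repr y)).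

Lemma iclassP (I J : nzideal) :
  (exists a b : OK, [/\ a != 0, b != 0 & ideal_scale a I = ideal_scale b J]) <->
  iclass I = iclass J.
Proof.
split=> [h|/eqP]; first by apply/eqP; rewrite eqmodE /=; apply/asboolP.
by rewrite eqmodE /= => /asboolP.
Qed.

Lemma iclass_repr x : iclass (repr x) = x.
Proof. exact: reprK. Qed.

Lemma Cl_mulE I J : Cl_mul (iclass I) (iclass J) = iclass (nzideal_mul I J).
Proof.
rewrite /Cl_mul; move: (repr _) (repr _) (iclass_repr (iclass I))
  (iclass_repr (iclass J)) => J' I'.
move=> /iclassP[a [b [a0 b0 e]]] /iclassP[a' [b' [a'0 b'0 e']]].
apply/iclassP; exists (a * a'), (b * b'); split; rewrite ?OK_mulf_neq0 //.
by rewrite /= -!ideal_scale_mul e e'.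
Qed.

Record prime_ideal := PrimeIdeal {
  prime_ideal_nz :> nzideal;
  prime_idealP : is_prime_ideal prime_ideal_nz }.

Lemma prime_ideal_below (Q : prime_ideal) :
  exists p : Primes, forall n : int, nzideal_set Q n%:~R <-> (val p %| n)%Z.
Proof.
have [[Q0 QD QM] Q1 QP] := prime_idealP Q.
have [x Qx /OK_norm[n [y [n0 en]]]] := nzideal_neq0 Q.
have Qn : nzideal_set Q n%:R by rewrite en; apply: QM.
have [p [p_pr Qp]] : exists p, prime p /\ nzideal_set Q p%:R.
  elim/ltn_ind: n n0 Qn {en} => n IHn n0 Qn.
  case: (ltnP 1 n) => [n1|n1]; last first.
    by case: Q1; move: n0 n1 Qn; case: n {IHn} => [|[|]].
  have pn := pdiv_dvd n; have p_pr := pdiv_prime n1.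
  have [||Qd] := QP (pdiv n)%:R (n %/ pdiv n)%:R.
  - by rewrite -natrM mulnC divnK.
  - by exists (pdiv n).
  have d0 : (0 < n %/ pdiv n)%N by rewrite divn_gt0 ?pdiv_gt0 // dvdn_leq.
  by apply: (IHn _ _ d0 Qd); rewrite ltn_Pdiv // prime_gt1.
exists (exist _ p p_pr) => k /=; split=> [Qk|/dvdzP[q ->]]; last first.
  by rewrite intrM; apply: QM.
case: (boolP (p %| k)%Z) => // pk; case: Q1.
have : coprimez p k by rewrite coprimezE /= prime_coprime.
case/coprimezP => -[u v] /= uv.
have := congr1 (fun z : int => z%:~R : OK) uv.
by rewrite intrD !intrM [X in _ = X -> _]mulr1z => <-; apply: QD; apply: QM.
Qed.

(* mu Q is the prime p with Q `&` Z = p Z. *)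
Definition mu (Q : prime_ideal) : Primes := sval (cid (prime_ideal_below Q)).

Lemma muP (Q : prime_ideal) (n : int) : nzideal_set Q n%:~R <-> (val (mu Q) %| n)%Z.
Proof. by rewrite /mu; case: cid. Qed.

End ClassGroup.

Section SplitPrimes.
Variable m : nat.

(* The primes p with (-m / p) = 1. For p = 2 the condition is -m = 1 mod 8, so
   that L is the set of primes that split in Q(sqrt(-m)). *)
Definition L : set Primes :=
  [set p | if val p == 2%N then (- m%:Z == 1 %[mod 8])%Z
           else ((- m%:R : 'F_(val p)) != 0) &&
                [exists x : 'F_(val p), x ^+ 2 == - m%:R]].

Definition E : set (Cl m) := [set x | Cl_mul x x = Cl_one m].

Definition f_of (l : Primes -> prime_ideal m) (p : Primes) : Cl m := iclass (l p).

Definition L0 (l : Primes -> prime_ideal m) : set Primes :=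
  (f_of l @^-1` E) `&` L.

Definition basis_classes : set (Pm m) :=
  [set x | exists (p : Primes) (t : triple m),
     [/\ L p, primitive t, 0 < tA t, 0 < tB t &
         (tC t = val p \/ tC t = (2 * val p)%N) /\ x = tclass t]].

End SplitPrimes.

Arguments E m : clear implicits.
Arguments basis_classes m : clear implicits.

(* Main.v *)
(** Let [w = sqrt(-m)], [K = Q(w)], and let [T] and [N] be the trace and the
    norm of an element of [O_K]. A class [[a,b,c]] is determined by
    [((a + b w) / c)^2], and this defines an injective homomorphism [phi] from
    [P_m] to the group of elements of norm 1.

    For [p] in [L] the prime ideal [P] over [p] has [P^2 = (z)], and then
    [N z = p^2] while [p] does not divide [T z]; up to sign and conjugation, [z]
    is the element [a + b w] or [(a + b w) / 2] of a basis class over [p].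
    Divisibility in [O_K] is decided on traces and norms alone, since an element
    of [K] with integral trace and norm is integral. In particular, if
    [p^2] divides [N y] and [p] does not divide [y], then [p] is in [L] and
    [p^2] divides [y z] or [y z^*]. This yields both generation, by descent on
    [c], and the uniqueness of the basis class over [p]. Independence holds
    because no positive multiple of the basis class over [p] is integral at [p]
    under [phi], while the other basis classes generate a subgroup of classes
    integral at [p]. *)

Require Import Defs.
From mathcomp Require Import all_boot all_order all_algebra all_field.
From mathcomp Require Import boolp classical_sets.
From mathcomp Require Import ring zify.

Set Implicit Arguments.
Unset Strict Implicit.
Unset Printing Implicit Defensive.

Import Order.TTheory GRing.Theory Num.Theory.

Local Open Scope ring_scope.
Local Open Scope classical_set_scope.

(** * Elements of [O_K] through their traces and norms *)

Local Notation w m := (sqrtC (- m%:R) : algC).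

Definition quad_int (m : nat) (T N : int) (z : algC) : Prop :=
  [/\ z \in is_OK m, z + z^* = T%:~R & z * z^* = N%:~R].

Lemma is_OKE (m : nat) z : (z \in is_OK m) = (z \in Qsqrt m) && (z \in Aint).
Proof. by []. Qed.

(** [z] is a root of the monic polynomial [X^2 - T X + N]. *)
Lemma Aint_quadratic (z : algC) (T N : int) :
  z + z^* = T%:~R -> z * z^* = N%:~R -> z \in Aint.
Proof.
move=> eT eN; pose p : {poly algC} := 'X^2 - T%:~R *: 'X + N%:~R%:P.
have pE : p = ('X - z%:P) * ('X - (z^*)%:P).
  rewrite /p -eT -eN -mul_polyC polyCD polyCM; ring.
apply: (@root_monic_Aint p).
- by rewrite pE rootM root_XsubC eqxx.
- by rewrite pE monicMl ?monicXsubC.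
apply/polyOverP => i; rewrite !coefE.
rewrite rpredD ?rpredB ?rpredM ?rpredMn ?rpred1 //; first exact: intr_int.
by case: ifP => _; rewrite ?rpred0 //; exact: intr_int.
Qed.

Lemma conj_Qsqrt_in (m : nat) z : z \in Qsqrt m -> z^* \in Qsqrt m.
Proof.
move=> /QsqrtP[u [v ->]]; apply/QsqrtP; exists u, (- v).
by rewrite conj_Qsqrt rmorphN mulNr.
Qed.

Lemma quad_intI (m : nat) (T N : int) z : z \in Qsqrt m ->
  z + z^* = T%:~R -> z * z^* = N%:~R -> quad_int m T N z.
Proof.
by move=> zK eT eN; split=> //; rewrite is_OKE zK; exact: Aint_quadratic eT eN.
Qed.

Lemma quad_int_conj (m : nat) (T N : int) z :
  quad_int m T N z -> quad_int m T N z^*.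
Proof.
move=> [/andP[zK _] eT eN]; apply: quad_intI; first exact: conj_Qsqrt_in.
  by rewrite conjCK addrC.
by rewrite conjCK mulrC.
Qed.

Lemma quad_int_exists (m : nat) z : z \in is_OK m ->
  exists T N : int, quad_int m T N z.
Proof.
move=> zO; have /andP[zK zA] := zO.
have zcA : z^* \in Aint by rewrite Aint_aut.
have [u [v ez]] := QsqrtP _ _ zK.
have /intrP[T eT] : z + z^* \is a Num.int.
  apply: Cint_rat_Aint; last by rewrite rpredD.
  by rewrite ez conj_Qsqrt addrACA subrr addr0 rpredD ?Crat_rat.
have /intrP[N eN] : z * z^* \is a Num.int.
  apply: Cint_rat_Aint; last by rewrite rpredM.
  by rewrite ez norm_Qsqrt Crat_rat.
by exists T, N.
Qed.

Lemma quad_intM (m : nat) (T N T' N' : int) z y :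
  quad_int m T N z -> quad_int m T' N' y ->
  exists S, quad_int m S (N * N') (z * y).
Proof.
move=> [zO _ eN] [yO _ eN']; have zyO : z * y \in is_OK m by rewrite rpredM.
have [S [M [_ eS eM]]] := quad_int_exists zyO; exists S; split=> //.
by rewrite intrM -eN -eN'; ring.
Qed.

Lemma OK_nat (m n : nat) : n%:R \in is_OK m.
Proof. by rewrite rpred_nat. Qed.

Lemma OK_intr (m : nat) (n : int) : n%:~R \in is_OK m.
Proof. by rewrite rpred_int. Qed.

Lemma OK_conj (m : nat) z : z \in is_OK m -> z^* \in is_OK m.
Proof. by move=> /quad_int_exists[T [N /quad_int_conj[]]]. Qed.

Lemma Aint_dvdz (p : nat) (n : int) : (0 < p)%N ->
  n%:~R / p%:R \in Aint -> (p %| n)%Z.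
Proof.
move=> p0 /Cint_rat_Aint h.
have /intrP[k ek] : (n%:~R / p%:R : algC) \is a Num.int.
  by apply: h; rewrite rpred_div ?rpred_nat ?rpred_int.
apply/dvdzP; exists k; apply: (@intr_inj algC).
by rewrite intrM -ek mulfVK // pnatr_eq0 -lt0n.
Qed.

Lemma natr_prime_neq0 (p : nat) : prime p -> p%:R != 0 :> algC.
Proof. by move=> p_pr; rewrite pnatr_eq0 -lt0n prime_gt0. Qed.

Lemma conjC_natr (n : nat) : (n%:R : algC)^* = n%:R.
Proof. by rewrite rmorph_nat. Qed.

Lemma conjC_intr (n : int) : (n%:~R : algC)^* = n%:~R.
Proof. by rewrite rmorph_int. Qed.

Lemma quad_int_div (m p : nat) (T N : int) z : (0 < p)%N ->
  quad_int m (T * p) (N * p ^+ 2) z -> quad_int m T N (z / p%:R).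
Proof.
move=> p0 [/andP[zK _] eT eN].
have p0' : p%:R != 0 :> algC by rewrite pnatr_eq0 -lt0n.
apply: quad_intI.
- by rewrite rpred_div // rpred_nat.
- by rewrite fmorph_div /= conjC_natr -mulrDl eT intrM mulfK.
rewrite fmorph_div /= conjC_natr mulrACA eN intrM rmorphXn /= -pmulrn.
by field.
Qed.

(* From [z^2 = T z - N], modulo a divisor of [N]. *)
Lemma quad_int_exp (m : nat) (p T N : int) z k :
  quad_int m T (N * p) z ->
  exists2 y, y \in is_OK m & z ^+ k.+1 = T%:~R ^+ k * z + p%:~R * y.
Proof.
move=> [zO eT eN]; elim: k => [|k [y yO IH]].
  by exists 0; rewrite ?rpred0 // mulr0 addr0 mul1r.
exists (y * z - T%:~R ^+ k * N%:~R).
  by rewrite rpredB ?rpredM ?rpredX ?OK_intr.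
have z2 : z ^+ 2 = T%:~R * z - (N * p)%:~R by rewrite -eT -eN; ring.
rewrite exprSr IH mulrDl -mulrA -expr2 z2 intrM exprSr; ring.
Qed.

(** By [quad_int_exp], [n z^(k+1) / p] differs from [n T^k z / p] by an integral element. Adding its
    conjugate to the latter gives [n T^(k+1) / p], a rational algebraic integer. *)
Lemma quad_int_trace_exp (m p : nat) (T N n : int) z k : (0 < p)%N ->
  quad_int m T (N * p) z -> n%:~R * z ^+ k.+1 / p%:R \in Aint ->
  (p %| n * T ^+ k.+1)%Z.
Proof.
move=> p0 qz; have [zO eT _] := qz.
have [y yO ->] := quad_int_exp k qz => h.
have p0' : p%:R != 0 :> algC by rewrite pnatr_eq0 -lt0n.
have : n%:~R * T%:~R ^+ k * z / p%:R \in Aint.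
  have -> : n%:~R * T%:~R ^+ k * z / p%:R =
     n%:~R * (T%:~R ^+ k * z + p%:~R * y) / p%:R - n%:~R * y.
    by field.
  have /andP[_ yA] := yO; by rewrite rpredB // rpredM // Aint_int.
move=> hA;
  have : (n%:~R * T%:~R ^+ k * z / p%:R)^* \in Aint by rewrite Aint_aut.
rewrite !(rmorphM, fmorphV) /= rmorphXn /= !conjC_intr conjC_natr => hA'.
apply: Aint_dvdz => //; rewrite intrM rmorphXn /= exprSr -eT.
rewrite [X in X \in _](_ : _ = n%:~R * T%:~R ^+ k * z / p%:R +
   n%:~R * T%:~R ^+ k * z^* / p%:R); last by rewrite eT -eT; field.
by rewrite rpredD.
Qed.

(** * Divisibility by a prime, read on traces and norms *)

Lemma Euclid_dvdzM (p : nat) (a b : int) : prime p ->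
  (p %| a * b)%Z = (p %| a)%Z || (p %| b)%Z.
Proof. by move=> p_pr; rewrite !dvdzE abszM Euclid_dvdM. Qed.

Lemma Euclid_dvdzX (p : nat) (a : int) k : prime p ->
  (p %| a ^+ k.+1)%Z = (p %| a)%Z.
Proof. by move=> p_pr; rewrite !dvdzE abszX Euclid_dvdX // andbT. Qed.

Lemma coprimez_prime_sqr (p : nat) (a : int) : prime p ->
  coprimez (p%:Z ^+ 2) a = ~~ (p %| a)%Z.
Proof.
by move=> p_pr; rewrite coprimezE abszX coprime_pexpl // prime_coprime // dvdzE.
Qed.

Lemma quad_int_dvd (m p : nat) (T N : int) z : prime p ->
  quad_int m T N z -> (p %| T)%Z -> (p ^+ 2 %| N)%Z -> z / p%:R \in is_OK m.
Proof.
move=> p_pr qz /dvdzP[T' eT] /dvdzP[N' eN]; rewrite eT eN in qz.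
by have [] := quad_int_div (prime_gt0 p_pr) qz.
Qed.

(* The traces S of zy and S' of zy^* satisfy S + S' = T T', which is prime to
   p, and S S' = N' (T^2 - 2N) + N (T'^2 - 2N'), which p^2 divides. *)
Lemma quad_int_mul_dvd (m p : nat) (T N T' N' : int) z y : prime p ->
  quad_int m T N z -> quad_int m T' N' y ->
  (p ^+ 2 %| N)%Z -> (p ^+ 2 %| N')%Z -> ~~ (p %| T)%Z -> ~~ (p %| T')%Z ->
  z * y / (p ^ 2)%:R \in is_OK m \/ z * y^* / (p ^ 2)%:R \in is_OK m.
Proof.
move=> p_pr qz qy pN pN' pT pT'.
have [S qS] := quad_intM qz qy.
have [S' qS'] := quad_intM qz (quad_int_conj qy).
have [[_ eT eN] [_ eT' eN']] := (qz, qy).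
have [[_ eS _] [_ eS' _]] := (qS, qS').
have eD : S + S' = T * T'.
  by apply: (@intr_inj algC); rewrite intrD intrM -eT -eT' -eS -eS';
     rewrite !rmorphM /= conjCK; ring.
have eM : S * S' = N' * (T ^+ 2 - 2 * N) + N * (T' ^+ 2 - 2 * N').
  apply: (@intr_inj algC).
  rewrite intrD !intrM !intrB !intrM -eT -eT' -eS -eS' -eN -eN'.
  by rewrite !rmorphM /= conjCK; ring.
have pM : (p ^+ 2 %| S * S')%Z by rewrite eM rpredD // dvdz_mulr.
have p2_gt0 : (0 < p ^ 2)%N by rewrite expn_gt0 prime_gt0.
have pNN : exists k, N * N' = k * (p ^ 2)%N%:Z ^+ 2.
  have /dvdzP[a ->] := pN; have /dvdzP[b ->] := pN'.
  by exists (a * b); rewrite -mulnn PoszM; ring.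
have [k eNN] := pNN.
have main s x : quad_int m s (N * N') x -> (p ^+ 2 %| s)%Z ->
    x / (p ^ 2)%:R \in is_OK m.
  move=> qx /dvdzP[r er]; rewrite eNN er in qx.
  suff qx' : quad_int m (r * (p ^ 2)%N) (k * (p ^ 2)%N%:Z ^+ 2) x.
    by have [] := quad_int_div p2_gt0 qx'.
  by move: qx; rewrite -mulnn PoszM -expr2.
case: (boolP (p %| S)%Z) => pS; [left; apply: main qS _|right;
  apply: main qS' _].
  rewrite -(@Gauss_dvdzl _ _ S') // coprimez_prime_sqr //.
  apply: contra pT => pS'.
  have : (p %| T * T')%Z by rewrite -eD rpredD.
  by rewrite Euclid_dvdzM // (negPf pT') orbF.
by rewrite -(@Gauss_dvdzr _ S) // coprimez_prime_sqr.
Qed.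

(** * Coordinates of integers of [K], and units *)

(** The squared denominator of [v] is coprime to the squared numerator, so it divides [m], and
    square-freeness makes the denominator 1. *)
Lemma square_free_rat (m : nat) (v : rat) (k : int) : square_free m ->
  m%:R * v ^+ 2 = k%:~R -> exists n : int, v = n%:~R.
Proof.
move=> sqf e.
have eZ : m%:Z * numq v ^+ 2 = k * denq v ^+ 2.
  apply: (@intr_inj rat); rewrite !intrM -e -pmulrn.
  by rewrite numqE; ring.
have cop : coprimez (denq v ^+ 2) (numq v ^+ 2).
  rewrite coprimezE !abszX coprime_pexpl // coprime_pexpr // coprime_sym.
  exact: coprime_num_den.
have := dvdz_mull k (dvdzz (denq v ^+ 2)).
rewrite -eZ (Gauss_dvdzl _ cop).
rewrite dvdzE abszX => /sqf ed; exists (numq v).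
rewrite -[LHS]divq_num_den; suff -> : denq v = 1 by rewrite divr1.
by rewrite -[LHS]gez0_abs ?denq_ge0 // ed.
Qed.

(** For [z = a + b w] the number [m (2b)^2 = 4N - T^2] is an integer, hence so is [2b]. Doubling [z]
    treats all residues of [m] modulo 4 at once. *)
Lemma quad_int_coords (m : nat) (T N : int) z : square_free m ->
  quad_int m T N z -> exists v : int,
    T ^+ 2 + m%:Z * v ^+ 2 = 4 * N /\ 2 * z = T%:~R + v%:~R * w m.
Proof.
move=> sqf [/andP[/QsqrtP[a [b ez]] _] eT eN].
have eTa : T%:~R = 2 * a :> rat.
  apply: (@fmorph_inj _ algC ratr);
    rewrite [LHS]rmorph_int [RHS]rmorphM /= -eT ez.
  by rewrite conj_Qsqrt rmorph_nat; ring.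
have eNa : N%:~R = a ^+ 2 + m%:R * b ^+ 2 :> rat.
  by apply: (@fmorph_inj _ algC ratr);
    rewrite [LHS]rmorph_int -eN ez norm_Qsqrt.
have [||v ev] := @square_free_rat m (2 * b) (4 * N - T ^+ 2) => //.
  by rewrite intrB intrM rmorphXn /= eTa eNa; ring.
exists v; split.
  apply: (@intr_inj rat).
  by rewrite intrD !intrM -pmulrn eTa eNa -ev; ring.
rewrite -!(ratr_int algC) eTa -ev ez !rmorphM /= rmorph_nat; ring.
Qed.

(** In [T^2 + m v^2 = 4], [m > 4] forces [v = 0]; the value [m = 4] is not square-free. *)
Lemma quad_int_unit (m : nat) (T : int) z : (3 < m)%N -> square_free m ->
  quad_int m T 1 z -> z = 1 \/ z = -1.
Proof.
move=> m3 sqf qz; have [v [eTv ez]] := quad_int_coords sqf qz.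
have m4 : m <> 4%N by move=> e; move: (sqf 2%N); rewrite e => /(_ isT).
have v0 : v = 0 by nia.
have two0 : 2%:R != 0 :> algC by rewrite pnatr_eq0.
have : T = 2 \/ T = -2 by rewrite v0 in eTv; nia.
move: ez; rewrite v0 mul0r addr0 => ez [] eT; rewrite eT in ez; [left|right].
  by apply: (mulfI two0); rewrite ez mulr1.
by apply: (mulfI two0); rewrite ez mulrN1 rmorphN.
Qed.

(** * Split primes and elements whose norm they divide *)

Lemma odd_sqr_mod8 (x : int) : ~~ (2 %| x)%Z -> exists k, x ^+ 2 = 8 * k + 1.
Proof.
move=> x2; have [q ->] : exists q, x = 2 * q + 1 by exists (x %/ 2)%Z; lia.
have [r er] : exists r, q * (q + 1) = 2 * r.
  exists (q * (q + 1) %/ 2)%Z.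
  have [s [->|->]] : exists s, q = 2 * s \/ q = 2 * s + 1.
    by exists (q %/ 2)%Z; lia.
  - by rewrite -mulrA mulKz // mulrC.
  - by rewrite [X in (X %/ _)%Z](_ : _ = 2 * ((2 * s + 1) * (s + 1))) ?mulKz //;
    ring.
exists r; have -> : (2 * q + 1) ^+ 2 = 4 * (q * (q + 1)) + 1 by ring.
by rewrite er; ring.
Qed.

Lemma Fp_intr_eq0 (p : nat) (n : int) : prime p ->
  (n%:~R == 0 :> 'F_p) = (p %| n)%Z.
Proof.
move=> p_pr; have pF := pchar_Fp p_pr.
case: n => n; first by rewrite -pmulrn -(dvdn_pcharf pF).
by rewrite NegzE rmorphN oppr_eq0 /= -pmulrn -(dvdn_pcharf pF) dvdzE abszN.
Qed.

(** For odd [p], reducing [T^2 + m v^2 = 4N] modulo [p] makes [-m] the square of [T / v]. For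
    [p = 2], [T] and [v] are odd, [N] is even, and the equation is read modulo 8. *)
Lemma split_of_quad_int (m : nat) (p : Primes) (T N : int) z : square_free m ->
  quad_int m T N z -> (val p %| N)%Z -> ~~ (val p %| T)%Z -> L m p.
Proof.
move=> sqf qz; have [v [eTv _]] := quad_int_coords sqf qz.
case: p => p p_pr /= => pN pT; rewrite /L /=; case: eqP => [e2|p2].
  rewrite e2 in pN pT.
  have v2 : ~~ (2 %| v)%Z.
    apply: contra pT => pv; rewrite -(@Euclid_dvdzX 2 T 1) //.
    have -> : T ^+ 2 = 4 * N - m%:Z * v ^+ 2 by rewrite -eTv addrK.
    by rewrite rpredB ?dvdz_mull // expr2 dvdz_mull.
  have [k ek] := odd_sqr_mod8 pT; have [k' ek'] := odd_sqr_mod8 v2.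
  have /dvdzP[n en] := pN; rewrite ek ek' en in eTv.
  by rewrite eqz_mod_dvd; apply/dvdzP; exists (k + m%:Z * k' - n); nia.
have eF : T%:~R ^+ 2 + m%:R * v%:~R ^+ 2 = 0 :> 'F_p.
  have /(congr1 (fun x : int => x%:~R : 'F_p)) := eTv.
  rewrite intrD !intrM -pmulrn => ->.
  by rewrite (eqP (_ : N%:~R == 0 :> 'F_p)) ?mulr0 // Fp_intr_eq0.
have T0 : T%:~R != 0 :> 'F_p by rewrite Fp_intr_eq0.
have v0 : v%:~R != 0 :> 'F_p.
  apply: contra T0 => /eqP v0; move: eF; rewrite v0 expr0n mulr0 addr0.
  by move=> /eqP; rewrite expf_eq0.
have m0 : m%:R != 0 :> 'F_p.
  apply: contra T0 => /eqP m0; move: eF; rewrite m0 mul0r addr0.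
  by move=> /eqP; rewrite expf_eq0.
rewrite oppr_eq0 m0 /=; apply/existsP; exists (T%:~R / v%:~R).
have eT : T%:~R ^+ 2 = - m%:R * v%:~R ^+ 2 :> 'F_p.
  by apply/eqP; rewrite -subr_eq0 mulNr opprK eF.
by rewrite expr_div_n eT mulfK // expf_neq0.
Qed.

Lemma gen_Qsqrt (m : nat) (a b : rat) : ratr a + ratr b * w m \in Qsqrt m.
Proof. by apply/QsqrtP; exists a, b. Qed.

Lemma quad_int_of_split (m : nat) (p : Primes) : L m p ->
  exists (z : algC) (T N : int),
    quad_int m T (N * val p) z /\ ~~ (val p %| T)%Z.
Proof.
case: p => p p_pr; rewrite /L /=; case: eqP => [->|p2].
  rewrite eqz_mod_dvd => /dvdzP[k ek].
  (* Since [-m - 1 = 8k], this element has norm [(1 + m) / 4 = -2k]. *)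
  exists ((1 + w m) / 2), 1, (- k); split=> //.
  have ez : (1 + w m) / 2 = ratr (1 / 2) + ratr (1 / 2) * w m.
    by rewrite fmorph_div /= rmorph1 rmorph_nat; field.
  have em : m%:R = -1 - (k * 8)%:~R :> algC.
    by rewrite -ek intrB intrN -pmulrn; ring.
  rewrite ez; apply: quad_intI; first exact: gen_Qsqrt.
    by rewrite conj_Qsqrt fmorph_div /= rmorph1 rmorph_nat; field.
  rewrite norm_Qsqrt rmorphD rmorphM !rmorphXn !fmorph_div /= rmorph1
    !rmorph_nat.
  by rewrite em !intrM intrN; field.
move=> /andP[m0 /existsP[x /eqP ex]].
have x0 : x != 0.
  by apply: contraNneq m0 => x0; rewrite -ex x0 expr0n.
have en : (val x)%:R = x by rewrite natr_Zp.
have /dvdzP[N eN] : (p %| (val x)%:Z ^+ 2 + m%:Z)%Z.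
  by rewrite -Fp_intr_eq0 // intrD intrM -!pmulrn en -expr2 ex addNr.
(* The lift of a square root [x] of [-m] gives norm [x^2 + m], divisible by [p], and trace [2x],
   prime to [p] as [p] is odd. *)
exists ((val x)%:R + w m), (2 * (val x)%:Z), N; split; last first.
  rewrite Euclid_dvdzM // negb_or; apply/andP; split.
    by rewrite dvdzE /= dvdn_prime2 //; apply/eqP.
  by rewrite -Fp_intr_eq0 // -pmulrn en.
have ez : (val x)%:R + w m = ratr (val x)%:R + ratr 1 * w m.
  by rewrite rmorph1 rmorph_nat mul1r.
rewrite -eN ez; apply: quad_intI; first exact: gen_Qsqrt.
  by rewrite conj_Qsqrt rmorph1 rmorph_nat intrM -pmulrn; ring.
rewrite norm_Qsqrt rmorphD rmorphM !rmorphXn /= rmorph1 !rmorph_nat.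
by rewrite intrD intrM -!pmulrn; ring.
Qed.

(** * A generator of the square of a prime ideal *)

Lemma OK_mulfI (m : nat) (a x y : OK m) : a != 0 -> a * x = a * y -> x = y.
Proof.
rewrite -(inj_eq val_inj) /= => a0 /(congr1 val) /= e.
by apply: val_inj; apply: (mulfI a0).
Qed.

(** From [a P^2 = c O_K] comes [b] in [P^2] with [a b = c]; cancelling [a] shows that [b] generates
    [P^2]. *)
Lemma principal_sqr (m : nat) (P : nzideal m) :
  Cl_mul (iclass P) (iclass P) = Cl_one m ->
  exists2 b : OK m, ideal_mul P P b &
    forall x y : OK m, nzideal_set P x -> nzideal_set P y ->
      exists d : OK m, x * y = b * d.
Proof.
rewrite Cl_mulE => /iclassP[a [c [a0 c0 e]]].
have [b Pb ab] : ideal_scale a (nzideal_mul P P) c.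
  by rewrite e; exists 1; rewrite ?mulr1.
exists b => // x y Px Py.
have [d _ cd] : ideal_scale c (nzideal1 m) (a * (x * y)).
  by rewrite -e; exists (x * y) => //; exact: ideal_mul_in.
by exists d; apply: (OK_mulfI a0); rewrite -cd -ab mulrA.
Qed.

Lemma quad_int_ge0 (m : nat) (T N : int) z : quad_int m T N z -> 0 <= N.
Proof. by move=> [_ _ eN]; rewrite -(ler0z algC) -eN mul_conjC_ge0. Qed.

(** Membership in [P] is transported to [algC], where conjugates and quotients by [p] can be written
    directly. *)
Definition val_ideal (m : nat) (P : prime_ideal m) (z : algC) : Prop :=
  exists2 x : OK m, nzideal_set P x & OK_val x = z.

Section PrimeIdealSquare.
Variables (m : nat) (P : prime_ideal m).
Local Notation p := (val (mu P)).
Local Notation I := (val_ideal P).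

Let p_pr : prime p. Proof. exact: valP. Qed.

Lemma val_ideal_OK z : I z -> z \in is_OK m.
Proof. by move=> [x _ <-]; exact: OK_valP. Qed.

Lemma val_idealD z y : I z -> I y -> I (z + y).
Proof.
move=> [x Px <-] [x' Px' <-]; exists (x + x') => //.
by have [[_ h _] _ _] := prime_idealP P; exact: h.
Qed.

Lemma val_idealM z y : z \in is_OK m -> I y -> I (z * y).
Proof.
move=> zO [x Px <-]; exists (MkOK zO * x) => //.
by have [[_ _ h] _ _] := prime_idealP P; exact: h.
Qed.

Lemma val_ideal_prime z y : z \in is_OK m -> y \in is_OK m -> I (z * y) -> I z
  \/ I y.
Proof.
move=> zO yO [x Px e]; have [_ _ h] := prime_idealP P.
have ex : x = MkOK zO * MkOK yO by apply: val_inj.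
rewrite ex in Px; have [Pz|Py] := h _ _ Px; [left|right].
  by exists (MkOK zO).
by exists (MkOK yO).
Qed.

Lemma val_ideal_intr (n : int) : I n%:~R <-> (p %| n)%Z.
Proof.
rewrite -muP; split=> [[x Px ex]|Pn]; last first.
  by exists n%:~R => //; exact: (rmorph_int (val : OK m -> algC)).
suff -> : n%:~R = x by [].
apply: val_inj; rewrite /= ex; exact: (rmorph_int (val : OK m -> algC)).
Qed.

Lemma val_ideal_norm (T N : int) z : quad_int m T N z -> I z -> (p %| N)%Z.
Proof.
move=> [zO _ eN] Iz; apply/val_ideal_intr; rewrite -eN mulrC.
by apply: val_idealM => //; exact: OK_conj.
Qed.

(* N (z + p) = N z + p T + p^2, so p^2 does not divide both N z and N (z + p). *)
Lemma prime_ideal_uniformizer : L m (mu P) ->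
  exists (z : algC) (T N : int),
    [/\ I z, quad_int m T (N * p) z, ~~ (p %| T)%Z & ~~ (p %| N)%Z].
Proof.
move=> /quad_int_of_split[z0 [T [N0 [qz0 pT]]]].
have [z [N [Iz qz]]] : exists z (N : int), I z /\ quad_int m T (N * p) z.
  have [zO _ eN] := qz0.
  have : I (z0 * z0^*) by rewrite eN; apply/val_ideal_intr; rewrite dvdz_mull.
  move=> /(val_ideal_prime zO (OK_conj zO))[Iz|Iz]; first by exists z0, N0.
  by exists z0^*, N0; split=> //; exact: quad_int_conj.
case: (boolP (p %| N)%Z) => pN; last by exists z, T, N.
have ec : (z + p%:R)^* = z^* + p%:R by rewrite rmorphD /= conjC_natr.
exists (z + p%:R), (T + 2 * p%:Z), (N + T + p%:Z); split.
- by apply: val_idealD => //; rewrite pmulrn; apply/val_ideal_intr.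
- have [/andP[zK _] eT eN] := qz; apply: quad_intI.
  + by rewrite rpredD // rpred_nat.
  + by rewrite ec intrD intrM -pmulrn -eT; ring.
  + rewrite ec.
    transitivity (z * z^* + (z + z^*) * p%:R + p%:R ^+ 2); first by ring.
    by rewrite eN eT !intrM !intrD -!pmulrn; ring.
- by apply: contra pT => h; rewrite -[T](addrK (2 * p%:Z)) rpredB // dvdz_mull.
- apply: contra pT => h.
  by rewrite (_ : T = N + T + p%:Z - N - p%:Z); [rewrite !rpredB|ring].
Qed.

(** The product of [P] and its conjugate lies in [(p)]: the trace of [y z^*] equals
    [T y + (y^* - y) z], an integer in [P], and each factor contributes one [p] to the norm. *)
Lemma prime_ideal_mul_conj (z y : algC) (T N : int) :
  quad_int m T (N * p) z -> I z -> I y -> y * z^* / p%:R \in is_OK m.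
Proof.
move=> qz Iz Iy; have yO := val_ideal_OK Iy; have [zO eT _] := qz.
have [Ty [Ny qy]] := quad_int_exists yO.
have [S qS] := quad_intM qy (quad_int_conj qz).
apply: (quad_int_dvd p_pr qS).
  have [_ eS _] := qS; apply/val_ideal_intr; rewrite -eS.
  have -> : y * z^* + (y * z^*)^* = T%:~R * y + (y^* - y) * z.
    by rewrite -eT rmorphM /= conjCK; ring.
  apply: val_idealD; apply: val_idealM => //; first exact: OK_intr.
  by rewrite rpredB // OK_conj.
have /dvdzP[k ->] := val_ideal_norm qy Iy.
by apply/dvdzP; exists (k * N); ring.
Qed.

(** The element sought is a generator [b] of [P^2]. Its norm divides [p^4] and [(N p)^2] with [N]
    prime to [p], hence divides [p^2]; the converse divisibility comes from multiplying by
    [z^* ^ 2]. *)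
Lemma prime_ideal_sqr_gen :
  Cl_mul (iclass P) (iclass P) = Cl_one m -> L m (mu P) ->
  exists (z : algC) (T : int), quad_int m T (p%:Z ^+ 2) z /\ ~~ (p %| T)%Z.
Proof.
move=> /principal_sqr[b [s [Ps eb]] b_dvd] /prime_ideal_uniformizer.
move=> [z [T [N [Iz qz pT pN]]]].
have p0 := natr_prime_neq0 p_pr.
have [Tb [Nb qb]] := quad_int_exists (OK_valP b).
have I_dvd x y : I x -> I y -> exists2 d, d \in is_OK m & x * y = OK_val b * d.
  move=> [x' Px <-] [y' Py <-]; have [d /(congr1 val) ed] := b_dvd _ _ Px Py.
  by exists (OK_val d) => //; exact: OK_valP.
(* Take norms in [x y = b d]. *)
have NbE x y (A B Nx Ny : int) : I x -> I y -> quad_int m A Nx x ->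
    quad_int m B Ny y -> (Nb %| Nx * Ny)%Z.
  move=> Ix Iy [_ _ ex] [_ _ ey]; have [d dO ed] := I_dvd _ _ Ix Iy.
  have [Td [Nd [_ _ eNd]]] := quad_int_exists dO.
  apply/dvdzP; exists Nd; apply: (@intr_inj algC); rewrite !intrM.
  have [_ _ <-] := qb; rewrite -ex -ey -eNd.
  transitivity ((x * y) * (x * y)^*); first by rewrite rmorphM /=; ring.
  by rewrite ed rmorphM /=; ring.
have Ip : I p%:R by rewrite pmulrn; apply/val_ideal_intr.
have qp : quad_int m (2 * p%:Z) (p%:Z ^+ 2) p%:R.
  split; first exact: OK_nat.
    by rewrite conjC_natr intrM -pmulrn; ring.
  by rewrite conjC_natr intrM -pmulrn.
have Nb4 := NbE _ _ _ _ _ _ Ip Ip qp qp.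
have Nb2 := NbE _ _ _ _ _ _ Iz Iz qz qz.
have Nb_p2 : (Nb %| p%:Z ^+ 2)%Z.
  have cop : coprimez Nb (N ^+ 2).
    rewrite coprimezE abszX coprime_pexpr //.
    apply: (@coprime_dvdl _ (p ^ 4)%N).
      by move: Nb4; rewrite dvdzE abszM abszX /= -expnD.
    by rewrite coprime_pexpl // prime_coprime // -[X in (_ %| X)%N]/`|N|%N;
      rewrite dvdzE in pN.
  by rewrite -(Gauss_dvdzr _ cop) (_ : _ * _ = N * p * (N * p)) //; ring.
have p2_Nb : (p%:Z ^+ 2 %| Nb)%Z.
  (* As [b] is a sum of products [q1 q2] of elements of [P], [y] is the sum of the
     [(q1 z^* / p) (q2 z^* / p)], so it is integral. Its norm is [Nb N^2 / p^2]. *)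
  pose y := OK_val b * z^* ^+ 2 / p%:R ^+ 2.
  have yO : y \in is_OK m.
    have -> : y = \sum_(q <- s) (OK_val q.1 * z^* / p%:R) * (OK_val q.2 * z^* /
      p%:R).
      have -> : y = (\sum_(q <- s) OK_val q.1 * OK_val q.2) * (z^* / p%:R) ^+ 2.
        rewrite /y eb -mulrA expr_div_n; congr (_ * _).
        exact: (rmorph_sum (val : OK m -> algC)).
      by rewrite mulr_suml; apply: eq_bigr => q _; field.
    rewrite big_seq; apply: rpred_sum => q /Ps[P1 P2].
    by rewrite rpredM //; apply: (prime_ideal_mul_conj qz Iz);
      [exists q.1|exists q.2].
  have [Ty [Ny [_ _ eNy]]] := quad_int_exists yO.
  have e : Nb * N ^+ 2 = Ny * p%:Z ^+ 2.
    apply: (@intr_inj algC); rewrite !intrM -pmulrn.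
    have [[_ _ eNb] [_ _]] := (qb, qz); rewrite intrM -pmulrn => ez.
    have -> : N%:~R = z * z^* / p%:R :> algC by rewrite ez mulfK.
    rewrite -eNb -eNy /y fmorph_div /= rmorphM !rmorphXn /= conjC_natr conjCK.
    by field.
  have cop : coprimez (p%:Z ^+ 2) (N ^+ 2).
    by rewrite coprimez_prime_sqr // Euclid_dvdzX.
  by rewrite -(Gauss_dvdzl _ cop) e dvdz_mull.
have eNb : Nb = p%:Z ^+ 2.
  rewrite -[LHS]gez0_abs ?(quad_int_ge0 qb) // -[RHS]gez0_abs ?exprn_ge0 //.
  by congr Posz; apply/eqP; rewrite eqn_dvd -!dvdzE Nb_p2 p2_Nb.
rewrite eNb in qb; exists (OK_val b), Tb; split=> //; apply/negP => pTb.
(* With [b / p] integral, so is [z^2 / p = (b / p) d], and then [p] divides [T^2]. *)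
have bO := quad_int_dvd p_pr qb pTb (dvdzz _).
have [d dO ed] := I_dvd _ _ Iz Iz.
have /(quad_int_trace_exp (prime_gt0 p_pr) qz) : 1%:~R * z ^+ 2 / p%:R \in Aint.
  rewrite mul1r expr2 ed mulrAC.
  by have /andP[] : OK_val b / p%:R * d \in is_OK m by rewrite rpredM.
by rewrite mul1r Euclid_dvdzX // (negPf pT).
Qed.

End PrimeIdealSquare.

(** * The injective homomorphism [phi] *)

Lemma intr_w_inj (m : nat) (a b a' b' : int) : (0 < m)%N ->
  a%:~R + b%:~R * w m = a'%:~R + b'%:~R * w m -> a = a' /\ b = b'.
Proof.
move=> m0 e; have w0 : w m != 0 by rewrite sqrtC_eq0 oppr_eq0 pnatr_eq0 -lt0n.
have two0 : 2%:R != 0 :> algC by rewrite pnatr_eq0.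
have e' : a%:~R - b%:~R * w m = a'%:~R - b'%:~R * w m.
  have /(congr1 Num.conj) := e.
  by rewrite !rmorphD /= !rmorphM /= !conj_gen !conjC_intr !mulrN.
have ea : a = a'.
  apply: (@intr_inj algC); apply: (mulfI two0).
  transitivity (a%:~R + b%:~R * w m + (a%:~R - b%:~R * w m)); first by ring.
  by rewrite e e'; ring.
split=> //; apply: (@intr_inj algC); apply: (mulIf w0).
by move: e; rewrite ea => /addrI.
Qed.

Definition talpha (m : nat) (t : triple m) : algC :=
  ((tA t)%:~R + (tB t)%:~R * w m) / (tC t)%:R.

(* The square removes the ambiguity of sign of talpha on a class. *)
Definition phi (m : nat) (x : Pm m) : algC := talpha (repr x) ^+ 2.

Lemma tC_neq0 (m : nat) (t : triple m) : (tC t)%:R != 0 :> algC.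
Proof. by rewrite pnatr_eq0 -lt0n tC_gt0. Qed.

Lemma triple_quad_int (m : nat) (t : triple m) :
  quad_int m (2 * tA t) ((tC t)%:Z ^+ 2) ((tA t)%:~R + (tB t)%:~R * w m).
Proof.
have e : (tA t)%:~R + (tB t)%:~R * w m =
    ratr (tA t)%:~R + ratr (tB t)%:~R * w m by rewrite !ratr_int.
rewrite e; apply: quad_intI; first exact: gen_Qsqrt.
  by rewrite conj_Qsqrt !ratr_int intrM; ring.
rewrite norm_Qsqrt -tripleE -(ratr_int algC); congr ratr.
by rewrite intrD !intrM -pmulrn.
Qed.

Lemma talpha_norm (m : nat) (t : triple m) : talpha t * (talpha t)^* = 1.
Proof.
have [_ _ e] := triple_quad_int t; have c0 := tC_neq0 t.
rewrite /talpha fmorph_div /= conjC_natr mulrACA e intrM -pmulrn.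
by field.
Qed.

Lemma talphaN (m : nat) (t : triple m) : talpha (tripleN t) = (talpha t)^*.
Proof.
rewrite /talpha fmorph_div /= rmorphD rmorphM /= conj_gen !conjC_intr
  conjC_natr.
by rewrite /tA /tB /tC /= intrN mulrN mulNr.
Qed.

Lemma talphaD (m : nat) (t u : triple m) :
  talpha (tripleD t u) = talpha t * talpha u.
Proof.
have c0 := tC_neq0 t; have d0 := tC_neq0 u.
have w2 := Qsqrt_gen m.
rewrite /talpha [tA (tripleD _ _)]/= [tB (tripleD _ _)]/= [tC (tripleD _ _)]/=.
rewrite intrB intrD !intrM -pmulrn natrM.
move: (w m) w2 => W w2.
have -> : m%:R = - W ^+ 2 :> algC by rewrite w2 opprK.
by field; rewrite c0 d0.
Qed.

Lemma talpha_sqr_class (m : nat) (t u : triple m) :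
  tclass t = tclass u -> talpha t ^+ 2 = talpha u ^+ 2.
Proof.
move=> /tclassP[s [r [s0 r0]]].
rewrite /tscale -/(tA t) -/(tB t) -/(tC t) -/(tA u) -/(tB u) -/(tC u).
move=> [ea eb ec].
have s0' : s%:~R != 0 :> algC by rewrite intr_eq0.
have r0' : r%:~R != 0 :> algC by rewrite intr_eq0.
have c0 := tC_neq0 t; have d0 := tC_neq0 u.
(* The equivalence fixes third components only up to sign, so only their squares are compared. *)
have ec2 : (s%:~R * (tC t)%:R) ^+ 2 = (r%:~R * (tC u)%:R) ^+ 2 :> algC.
  have : (s * tC t) ^+ 2 = (r * tC u) ^+ 2.
    by have [->|->] : s * tC t = r * tC u \/ s * tC t = - (r * tC u);
      [lia| |rewrite sqrrN].
  by move=> /(congr1 (fun z : int => z%:~R : algC));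
    rewrite !rmorphXn /= !intrM -!pmulrn.
have scale (k : int) (v : triple m) : k%:~R != 0 :> algC -> talpha v ^+ 2 =
   ((k * tA v)%:~R + (k * tB v)%:~R * w m) ^+ 2 / (k%:~R * (tC v)%:R) ^+ 2.
  by move=> k0; have v0 := tC_neq0 v; rewrite /talpha !intrM; field;
    rewrite k0 v0.
by rewrite (scale s t) // (scale r u) // ea eb ec2.
Qed.

Lemma phi_tclass (m : nat) (t : triple m) : phi (tclass t) = talpha t ^+ 2.
Proof. by apply: talpha_sqr_class; exact: tclass_repr. Qed.

Lemma phiD (m : nat) (x y : Pm m) : phi (x + y) = phi x * phi y.
Proof.
elim/Pm_ind: x => t; elim/Pm_ind: y => u.
have -> : tclass t + tclass u = tclass (tripleD t u) := Pm_addE t u.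
by rewrite !phi_tclass talphaD exprMn.
Qed.

Lemma phiN (m : nat) (x : Pm m) : phi (- x) = (phi x)^*.
Proof.
elim/Pm_ind: x => t; have -> : - tclass t = tclass (tripleN t) := Pm_oppE t.
by rewrite !phi_tclass talphaN rmorphXn.
Qed.

Lemma phi0 (m : nat) : phi (0 : Pm m) = 1.
Proof.
have -> : (0 : Pm m) = tclass (triple0 m) by [].
by rewrite phi_tclass /talpha /= mul0r addr0 divr1 expr1n.
Qed.

Lemma phi_muln (m : nat) (x : Pm m) k : phi (x *+ k) = phi x ^+ k.
Proof. by elim: k => [|k IH]; rewrite ?mulr0n ?phi0 // mulrS phiD IH exprS. Qed.

(** This is the kernel of [phi]: [talpha t] is 1 or -1, and comparing coordinates gives [b = 0] and
    [a = c] or [a = -c]. *)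
Lemma talpha_sqr_eq1 (m : nat) (t : triple m) : (0 < m)%N ->
  talpha t ^+ 2 = 1 -> tB t = 0 /\ tclass t = 0.
Proof.
move=> m0 /eqP; rewrite sqrf_eq1 => h; have c0 := tC_neq0 t.
have [e [he eb]] : exists e : int, tA t = e * tC t /\ tB t = 0.
  have [e et] : exists e : int, talpha t = e%:~R.
    by case/orP: h => /eqP ->; [exists 1|exists (-1)].
  exists e; apply: (@intr_w_inj m) => //; rewrite mul0r addr0 intrM -pmulrn.
  by rewrite -et /talpha divfK.
split=> //; have := tripleE t; rewrite eb expr0n mulr0 addr0 => ea.
apply/tclassP; exists 1, (tA t); split=> //.
  by rewrite -sqrf_eq0 ea sqrf_eq0 eqz_nat -lt0n tC_gt0.
rewrite /tscale /= -/(tA t) -/(tB t) -/(tC t) eb !mul1r !mulr0 mulr1 mul1n.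
congr (_, _, _).
by have /eqP := congr1 absz ea; rewrite !abszX eqn_sqr => /eqP ->.
Qed.

Lemma phi_inj (m : nat) : (0 < m)%N -> injective (@phi m).
Proof.
move=> m0 x y e; apply/eqP; rewrite -subr_eq0; apply/eqP.
have : phi (x - y) = 1.
  by rewrite phiD phiN -e -phiN -phiD subrr phi0.
by elim/Pm_ind: (x - y) => t; rewrite phi_tclass => /talpha_sqr_eq1[].
Qed.

(** * Existence and uniqueness of the basis class over a split prime *)

(** The element is [a + b w], or its half when [c = 2p]. If [p] divided its trace, [talpha t] would
    be integral of norm 1, hence a unit 1 or -1, forcing [b = 0]. *)
Lemma basis_quad_int (m p : nat) (t : triple m) : prime p ->
  (3 < m)%N -> square_free m -> tB t != 0 -> tC t = p \/ tC t = (2 * p)%N ->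
  exists2 T, quad_int m T (p%:Z ^+ 2) (talpha t * p%:R) & ~~ (p %| T)%Z.
Proof.
move=> p_pr m3 sqf b0 tc; have p0 := natr_prime_neq0 p_pr.
have qt := triple_quad_int t.
have [T qT] : exists T, quad_int m T (p%:Z ^+ 2) (talpha t * p%:R).
  case: tc => ec; rewrite /talpha; rewrite ec in qt *.
    by exists (2 * tA t); rewrite divfK //; exact: qt.
  have qt' : quad_int m (tA t * 2%N) (p%:Z ^+ 2 * 2%N%:Z ^+ 2)
      ((tA t)%:~R + (tB t)%:~R * w m).
    rewrite mulrC (_ : p%:Z ^+ 2 * _ = (2 * p)%N%:Z ^+ 2); first exact: qt.
    by rewrite PoszM; ring.
  exists (tA t); have := quad_int_div (isT : (0 < 2)%N) qt'.
  by congr quad_int; rewrite natrM; field.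
exists T => //; apply/negP => pT.
have := quad_int_dvd p_pr qT pT (dvdzz _); rewrite mulfK // => tO.
have [S [N qS]] := quad_int_exists tO.
have N1 : N = 1 by have [_ _] := qS;
  rewrite talpha_norm => /(@intr_inj algC 1 N).
rewrite N1 in qS.
have t2 : talpha t ^+ 2 = 1.
  by have [->|->] := quad_int_unit m3 sqf qS; rewrite ?sqrrN expr1n.
by have [e _] := talpha_sqr_eq1 (ltn_trans (isT : 0 < 3)%N m3) t2;
  rewrite e eqxx in b0.
Qed.

(** By [quad_int_mul_dvd], [talpha t] times [talpha u] or times its conjugate is integral of norm 1,
    so it is 1 or -1. The second case gives equal values of [phi]; positivity excludes the first. *)
Lemma basis_class_uniq (m p : nat) (t u : triple m) : prime p ->
  (3 < m)%N -> square_free m ->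
  0 < tA t -> 0 < tB t -> 0 < tA u -> 0 < tB u ->
  tC t = p \/ tC t = (2 * p)%N -> tC u = p \/ tC u = (2 * p)%N ->
  tclass t = tclass u.
Proof.
move=> p_pr m3 sqf ta tb ua ub tc uc; have m0 := ltn_trans (isT : 0 < 3)%N m3.
have p0 := natr_prime_neq0 p_pr.
have [T qt pT] := basis_quad_int p_pr m3 sqf (lt0r_neq0 tb) tc.
have [U qu pU] := basis_quad_int p_pr m3 sqf (lt0r_neq0 ub) uc.
have unit1 z : z * z^* = 1 -> z \in is_OK m -> z = 1 \/ z = -1.
  move=> ez /quad_int_exists[S [N qz]].
  have N1 : N = 1 by have [_ _] := qz; rewrite ez => /(@intr_inj algC 1 N).
  by rewrite N1 in qz; exact: quad_int_unit m3 sqf qz.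
have nt := talpha_norm t; have nu := talpha_norm u.
have [] := quad_int_mul_dvd p_pr qt qu (dvdzz _) (dvdzz _) pT pU.
- rewrite (_ : _ / _ = talpha t * talpha u); last by rewrite natrX; field.
  (* Here [talpha t] is [e] times the conjugate of [talpha u] with [e] equal to 1 or -1: the signs
     of the [a]'s require [e = 1], those of the [b]'s [e = -1]. *)
  move=> /unit1 h; exfalso.
  have [e et] : exists e : int, (e = 1 \/ e = -1) /\ talpha t = e%:~R * (talpha
    u)^*.
    have ett : talpha t = talpha t * talpha u * (talpha u)^*
      by rewrite -mulrA nu mulr1.
    have [|e|e] := h;
      first by rewrite [(talpha t * _)^*]rmorphM /= mulrACA nt nu mulr1.
      by exists 1; split; [left|rewrite [LHS]ett e].
    by exists (-1); split; [right|rewrite [LHS]ett e].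
  have c0 := tC_neq0 t; have d0 := tC_neq0 u; case: et => e1.
  rewrite -talphaN /talpha {2}/tA {2}/tB {2}/tC /= => et.
  have [|ea eb] := @intr_w_inj m (tA t * tC u) (tB t * tC u)
      (e * tA u * tC t) (- e * tB u * tC t) m0.
    have -> : (tA t * tC u)%:~R + (tB t * tC u)%:~R * w m =
       ((tA t)%:~R + (tB t)%:~R * w m) / (tC t)%:R * (tC t)%:R * (tC u)%:R.
      by rewrite divfK // !intrM -!pmulrn; ring.
    by rewrite et !intrM !intrN -!pmulrn; field.
  have := tC_gt0 t; have := tC_gt0 u; case: e1 => e1; rewrite e1 in ea eb; nia.
rewrite rmorphM /= conjC_natr.
rewrite (_ : _ / _ = talpha t * (talpha u)^*); last by rewrite natrX; field.
move=> /unit1 h; apply: (phi_inj m0); rewrite !phi_tclass.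
have ett : talpha t = talpha t * (talpha u)^* * talpha u
  by rewrite -mulrA [_^* * _]mulrC nu mulr1.
have [|e|e] := h;
  first
    by rewrite [(talpha t * _)^*]rmorphM /= conjCK mulrACA nt [_^* * _]mulrC nu
      mulr1.
  by rewrite [in LHS]ett e mul1r.
by rewrite [in LHS]ett e mulN1r sqrrN.
Qed.

(** Write [2 z = T + v w]. For even [T] the triple is [(|T|/2, |v|/2, p)], for odd [T] it is
    [(|T|, |v|, 2p)]. It is primitive because [p] does not divide [T]. *)
Lemma basis_class_exists (m : nat) (p : Primes) (T : int) z : (3 < m)%N ->
  square_free m -> L m p -> quad_int m T ((val p)%:Z ^+ 2) z ->
  ~~ (val p %| T)%Z ->
  exists t : triple m, [/\ primitive t, 0 < tA t, 0 < tB t,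
    tC t = val p \/ tC t = (2 * val p)%N & basis_classes m (tclass t)].
Proof.
move=> m3 sqf Lp qz pT; have [v [eTv _]] := quad_int_coords sqf qz.
have p_pr : prime (val p) by exact: valP.
suff [t [h1 h2 h3 h4]] : exists t : triple m, [/\ primitive t, 0 < tA t, 0 < tB
  t
    & tC t = val p \/ tC t = (2 * val p)%N].
  by exists t; split=> //; exists p, t.
move: (val p) p_pr qz pT eTv => q q_pr {}qz qT eTv {p Lp}.
have q_gt0 := prime_gt0 q_pr.
have T0 : T != 0 by apply: contraNneq qT => ->; rewrite dvdz0.
have v0 : v != 0.
  apply: contraNneq qT => v0; rewrite -(@Euclid_dvdzX q T 1) //.
  move: eTv; rewrite v0 expr0n mulr0 addr0 => ->.
  by rewrite dvdz_mull // expr2 dvdz_mull.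
have gcd1 (g a : nat) : (g %| q)%N -> (g %| a)%N -> (a %| `|T|)%N -> g = 1%N.
  move=> gq ga aT; have /primeP[_ /(_ _ gq)/orP[/eqP //|/eqP eg]] := q_pr.
  by move: qT; rewrite dvdzE /= -eg (dvdn_trans ga aT).
case: (boolP (2 %| T)%Z) => T2.
  have /dvdzP[a ea] := T2.
  have v2 : (2 %| v)%Z.
    (* If [v] were odd, [T] being even, [4] would divide [m]. *)
    apply/negPn/negP => v2; have [k ek] := odd_sqr_mod8 v2.
    suff : (2 ^ 2 %| m)%N by move=> /sqf.
    rewrite ea ek in eTv.
    have : (4 %| m%:Z)%Z by apply/dvdzP;
      exists (q%:Z ^+ 2 - a ^+ 2 - m%:Z * k * 2); lia.
    by rewrite dvdzE.
  have /dvdzP[b eb] := v2; rewrite ea eb in eTv T0 v0.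
  have it : is_triple m (`|a|%N%:Z, `|b|%N%:Z, q).
    rewrite /is_triple /= q_gt0 /=; apply/eqP;
      rewrite !abszE !real_normK ?num_real //.
    lia.
  exists (Triple it); rewrite /primitive /tA /tB /tC /=; split;
    [|lia|lia|by left].
  apply: (gcd1 _ `|a|%N); rewrite ?dvdn_gcdr //.
    by apply: dvdn_trans (dvdn_gcdl _ _) _; exact: dvdn_gcdl.
  by rewrite ea abszM dvdn_mulr.
have it : is_triple m (`|T|%N%:Z, `|v|%N%:Z, (2 * q)%N).
  rewrite /is_triple /= muln_gt0 q_gt0 /=; apply/eqP;
    rewrite !abszE !real_normK ?num_real //.
  by rewrite eTv PoszM; ring.
exists (Triple it); rewrite /primitive /tA /tB /tC /=; split;
  [|lia|lia|by right].
set g := gcdn _ _.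
have gT : (g %| `|T|)%N by apply: dvdn_trans (dvdn_gcdl _ _) _;
  exact: dvdn_gcdl.
apply: (gcd1 _ `|T|%N) => //.
(* As a divisor of the odd [T], [g] is odd, so [g] dividing [2q] divides [q]. *)
have cop : coprime g 2.
  apply: (@coprime_dvdl _ `|T|) => //.
  by rewrite coprime_sym prime_coprime //; rewrite dvdzE in T2.
by rewrite -(Gauss_dvdr _ cop) dvdn_gcdr.
Qed.

(** * Generation by descent *)

(** Lists without repetition let [in_spanD] change the coefficient of a single element. *)
Definition in_span (V : zmodType) (B : set V) (x : V) : Prop :=
  exists (s : seq V) (n : V -> int),
    [/\ uniq s, (forall b, b \in s -> B b) & x = \sum_(b <- s) b *~ n b].

Lemma in_span0 (V : zmodType) (B : set V) : in_span B 0.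
Proof. by exists [::], (fun=> 0); split=> //; rewrite big_nil. Qed.

Lemma in_spanD (V : zmodType) (B : set V) (x b : V) (k : int) :
  B b -> in_span B x -> in_span B (x + b *~ k).
Proof.
move=> Bb [s [n [us sB ->]]].
pose n' c := if c == b then (if b \in s then n b + k else k) else n c.
have off (r : seq V) : \sum_(c <- r | c != b) c *~ n' c =
    \sum_(c <- r | c != b) c *~ n c.
  by apply: eq_bigr => c; rewrite /n' => /negPf ->.
case: (boolP (b \in s)) => bs.
  exists s, n'; split=> //.
  rewrite (bigD1_seq b) //= [RHS](bigD1_seq b) //= off {1}/n' eqxx bs.
  by rewrite mulrzDr addrAC.
exists (b :: s), n'; split.
- by rewrite /= bs.
- by move=> c; rewrite inE => /orP[/eqP ->|/sB].
rewrite big_cons {1}/n' eqxx (negPf bs) addrC; congr (_ + _).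
rewrite [RHS]big_seq [LHS]big_seq; apply: eq_bigr => c cs; rewrite /n'.
by case: eqP => // ec; rewrite -ec cs in bs.
Qed.

Section Generation.
Variable m : nat.
Hypotheses (m3 : (3 < m)%N) (sqf : square_free m).

(** The assumption [L0 = L] enters the descent in this form, by way of [prime_ideal_sqr_gen]. *)
Hypothesis split_gen : forall p : Primes, L m p -> exists (z : algC) (T : int),
  quad_int m T ((val p)%:Z ^+ 2) z /\ ~~ (val p %| T)%Z.

Let m0 : (0 < m)%N := ltn_trans (isT : (0 < 3)%N) m3.

(* A prime divisor p of c either divides z or splits; in the latter case adding
   or subtracting the basis class over p divides c by p. *)
Lemma descent (c : nat) (z : algC) (T : int) (x : Pm m) : (0 < c)%N ->
  quad_int m T (c%:Z ^+ 2) z -> phi x = (z / c%:R) ^+ 2 ->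
  in_span (basis_classes m) x.
Proof.
elim/ltn_ind: c z T x => c IH z T x c_gt0 qz ex.
have [c1|c1] := leqP c 1.
  have ec : c = 1%N by apply/eqP; rewrite eqn_leq c1.
  rewrite ec expr1n in qz; rewrite ec divr1 in ex.
  suff -> : x = 0 by exact: in_span0.
  apply: (phi_inj m0); rewrite phi0 ex.
  by have [->|->] := quad_int_unit m3 sqf qz; rewrite ?sqrrN expr1n.
have [p p_pr p_dvd] : exists2 p, prime p & (p %| c)%N.
  by exists (pdiv c); [exact: pdiv_prime|exact: pdiv_dvd].
have p0 := natr_prime_neq0 p_pr; have p_gt0 := prime_gt0 p_pr.
pose c' := (c %/ p)%N; have ec : c = (c' * p)%N by rewrite divnK.
have c'_gt0 : (0 < c')%N by move: c_gt0; rewrite ec muln_gt0 => /andP[].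
have c'0 : c'%:R != 0 :> algC by rewrite pnatr_eq0 -lt0n.
have c'_lt : (c' < c)%N by rewrite ltn_Pdiv // prime_gt1.
have eN : c%:Z ^+ 2 = c'%:Z ^+ 2 * p%:Z ^+ 2 by rewrite ec PoszM exprMn.
case: (boolP (p %| T)%Z) => [/dvdzP[T' eT]|pT].
  rewrite eT eN in qz; apply: (IH _ c'_lt _ _ _ c'_gt0 (quad_int_div p_gt0 qz)).
  by rewrite ex ec natrM; congr (_ ^+ 2); field; rewrite c'0 p0.
pose P : Primes := exist _ p p_pr.
have pN : (p%:Z ^+ 2 %| c%:Z ^+ 2)%Z by rewrite eN dvdz_mull.
have LP : L m P.
  apply: (@split_of_quad_int m P T _ z sqf qz) => //.
  by apply: dvdz_trans pN; rewrite expr2 dvdz_mull.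
have [y [U [qy pU]]] := split_gen LP.
have [t [_ _ tb tc tB]] := basis_class_exists m3 sqf LP qy pU.
have [S qt pS] := basis_quad_int p_pr m3 sqf (lt0r_neq0 tb) tc.
(* [u] will be [talpha t] or its conjugate, and [k] the basis class or its opposite; the new element
   has norm [c'^2], so the induction hypothesis applies. *)
have step (u : algC) (k : Pm m) : u * u^* = 1 -> phi k = u ^+ 2 ->
    z * (u * p%:R) / (p ^ 2)%:R \in is_OK m -> in_span (basis_classes m) (x +
      k).
  move=> nu ek yO; have [T' [N' qy']] := quad_int_exists yO.
  have eN' : N' = c'%:Z ^+ 2.
    apply: (@intr_inj algC); have [_ _ <-] := qy'.
    have [_ _ ez] := qz; rewrite eN in ez.
    rewrite natrX [_^*]fmorph_div /= !rmorphM /= !conjC_natr.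
    transitivity (z * z^* * (u * u^*) / p%:R ^+ 2); first by field.
    by rewrite ez nu !intrM -!pmulrn; field.
  rewrite eN' in qy'; apply: (IH _ c'_lt _ _ _ c'_gt0 qy').
  by rewrite phiD ex ek ec natrX natrM; field; rewrite c'0 p0.
have [yO|yO] := quad_int_mul_dvd p_pr qz qt pN (dvdzz _) pT pS.
  rewrite -(addrK (tclass t) x) -[- tclass t]mulrN1z; apply: in_spanD => //.
  by apply: (step (talpha t)); rewrite ?talpha_norm ?phi_tclass.
rewrite -(subrK (tclass t) x) -[X in _ + X]mulr1z; apply: in_spanD => //.
apply: (step (talpha t)^*).
- by rewrite conjCK mulrC talpha_norm.
- by rewrite phiN phi_tclass rmorphXn.
by move: yO; rewrite [(talpha t * _)^*]rmorphM /= conjC_natr.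
Qed.

Lemma basis_span (x : Pm m) : in_span (basis_classes m) x.
Proof.
elim/Pm_ind: x => t; apply: (descent (tC_gt0 t) (triple_quad_int t)).
exact: phi_tclass.
Qed.

End Generation.

(** * Independence by integrality at a prime *)

(** [phi x] has a denominator prime to [p]; these classes form a subgroup. *)
Definition integral_at (m p : nat) (x : Pm m) : Prop :=
  exists2 n : int, ~~ (p %| n)%Z & n%:~R * phi x \in Aint.

Lemma integral_atD (m p : nat) (x y : Pm m) : prime p ->
  integral_at p x -> integral_at p y -> integral_at p (x + y).
Proof.
move=> p_pr [n pn nx] [k pk ky]; exists (n * k).
  by rewrite Euclid_dvdzM // negb_or pn.
by rewrite phiD intrM mulrACA rpredM.
Qed.

Lemma integral_atN (m p : nat) (x : Pm m) :
  integral_at p x -> integral_at p (- x).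
Proof.
move=> [n pn nx]; exists n => //; rewrite phiN -conjC_intr -rmorphM.
by rewrite Aint_aut.
Qed.

Lemma integral_at0 (m p : nat) : prime p -> integral_at p (0 : Pm m).
Proof.
move=> p_pr; exists 1; last by rewrite phi0 mulr1 rpred1.
by rewrite dvdzE dvdn1 neq_ltn prime_gt1 ?orbT.
Qed.

Lemma integral_atMz (m p : nat) (x : Pm m) (k : int) : prime p ->
  integral_at p x -> integral_at p (x *~ k).
Proof.
move=> p_pr px.
have pos (j : nat) : integral_at p (x *+ j).
  elim: j => [|j IH]; first by rewrite mulr0n; exact: integral_at0.
  by rewrite mulrS; exact: integral_atD.
case: k => j; first by rewrite -pmulrn.
by rewrite NegzE mulrNz -pmulrn; apply: integral_atN.
Qed.

Lemma talpha_integral (m p q : nat) (T : int) (t : triple m) : prime p ->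
  prime q -> p != q -> quad_int m T (q%:Z ^+ 2) (talpha t * q%:R) ->
  integral_at p (tclass t).
Proof.
move=> p_pr q_pr pq [/andP[_ zA] _ _]; exists (q%:Z ^+ 2).
  by rewrite Euclid_dvdzX // dvdzE dvdn_prime2.
by rewrite phi_tclass intrM -pmulrn -expr2 -exprMn mulrC rpredX.
Qed.

(** Otherwise [n (p talpha t)^(2k+2) / p] would be integral for some [n] prime to [p], and by
    [quad_int_trace_exp] [p] would divide [n T^(2k+2)]. *)
Lemma talpha_not_integral (m p : nat) (T : int) (t : triple m) (k : nat) :
  prime p -> quad_int m T (p%:Z ^+ 2) (talpha t * p%:R) -> ~~ (p %| T)%Z ->
  ~ integral_at p (tclass t *+ k.+1).
Proof.
move=> p_pr qt pT [n pn]; rewrite phi_muln phi_tclass -exprM => nA.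
have p0 := natr_prime_neq0 p_pr.
rewrite mulnS !addSn add0n in nA.
have : n%:~R * (talpha t * p%:R) ^+ (2 * k).+2 / p%:R \in Aint.
  rewrite exprMn mulrA; move: (_ * _ ^+ _) nA => y yA.
  rewrite exprSr mulrA mulfK // rpredM //.
  by rewrite rpredX // rpred_nat.
move=> /(quad_int_trace_exp (prime_gt0 p_pr) qt).
by rewrite Euclid_dvdzM // Euclid_dvdzX // (negPf pn) (negPf pT).
Qed.

Lemma basis_free (m : nat) (s : seq (Pm m)) (n : Pm m -> int) :
  (3 < m)%N -> square_free m -> uniq s ->
  (forall b, b \in s -> basis_classes m b) ->
  \sum_(b <- s) b *~ n b = 0 -> forall b, b \in s -> n b = 0.
Proof.
move=> m3 sqf us sB e0 b bs; apply/eqP/negPn/negP => nb0.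
have [P [t [LP _ ta tb [tc eb]]]] := sB _ bs.
have p_pr : prime (val P) by exact: valP.
have [T qt pT] := basis_quad_int p_pr m3 sqf (lt0r_neq0 tb) tc.
(* By [basis_class_uniq], the basis classes other than [b] lie over other primes. *)
have rest : integral_at (val P) (\sum_(c <- s | c != b) c *~ n c).
  rewrite big_seq_cond; apply: (big_ind (integral_at (val P))).
  - exact: integral_at0.
  - by move=> x y; exact: integral_atD.
  move=> c /andP[cs cb]; apply: integral_atMz => //.
  have [Q [u [_ _ ua ub [uc ec]]]] := sB _ cs.
  have q_pr : prime (val Q) by exact: valP.
  have [U qu _] := basis_quad_int q_pr m3 sqf (lt0r_neq0 ub) uc.
  rewrite ec; apply: (talpha_integral p_pr q_pr _ qu).
  apply: contra cb => /eqP epq; rewrite -epq in uc.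
  by rewrite ec eb; apply/eqP; exact: (basis_class_uniq p_pr).
have nb : integral_at (val P) (b *~ n b).
  move: e0; rewrite (bigD1_seq b) //= => /eqP; rewrite addr_eq0 => /eqP ->.
  exact: integral_atN.
(* The sign of [n b] is immaterial, integrality at a prime being stable under opposites. *)
have [k ek] : exists k, `|n b|%N = k.+1 by exists `|n b|.-1%N;
  rewrite prednK // absz_gt0.
apply: (talpha_not_integral (k := k) p_pr qt pT); rewrite -eb -ek.
case: (n b) nb => j /=; first by rewrite -pmulrn.
by rewrite NegzE mulrNz -pmulrn => /integral_atN; rewrite opprK.
Qed.

Theorem theorem1 (m : nat) (l : Primes -> prime_ideal m) :
  (3 < m)%N -> square_free m ->
  (forall p : Primes, mu (l p) = p) ->
  L0 l = L m ->
  free_abelian (Pm m) /\ Z_basis (basis_classes m).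
Proof.
move=> m3 sqf lP eL.
suff B : Z_basis (basis_classes m) by split=> //; exists (basis_classes m).
split=> [x|s n us sB e]; last exact: basis_free.
have [|s [n [_ sB ->]]] := @basis_span m m3 sqf _ x; last by exists s, n.
(* By [L0 = L] the class of [l p] has trivial square, and [l p] lies over [p]. *)
move=> p Lp; have := Lp; rewrite -eL => -[Ep _].
have := prime_ideal_sqr_gen Ep; rewrite lP; exact.
Qed.
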